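(* Let $A$ be a finite set, let $k>1$ be an integer, and let $\mathcal{M}_k$ be the set of all clones on $A$ that contain a $k$-edge operation. Then: (1) for every $\mathcal{C}\in\mathcal{M}_k$ there is a finitary relation $R$ on $A$ with $\mathcal{C}=\mathrm{Pol}(A,\{R\})$; (2) there is no infinite strictly descending chain in $(\mathcal{M}_k,\subseteq)$; (3) $\mathcal{M}_k$ is finite or countably infinite.
   Context: A clone on $A$ is a set of finitary operations (of positive arity) on $A$ closed under composition and containing all projections. A $k$-edge operation ($k\ge2$) is $t:A^{k+1}\to A$ with $t(y,y,x,\dots,x)=t(y,x,y,x,\dots,x)=x$ and $t(x,\dots,x,y,x,\dots,x)=x$ ($y$ in position $i$) for each $i\in\{4,\dots,k+1\}$, for all $x,y\in A$ (for $k=2$ this means $m(x,y,z):=t(y,x,z)$ is a Malcev operation, $m(x,y,y)=m(y,y,x)=x$). A finitary relation on $A$ is a subset $R\subseteq A^I$ for a finite set $I$; an operation preserves $R$ if $R$ is closed under it coordinatewise. For a set $S$ of finitary relations, $\mathrm{Pol}(A,S)$ is the set of all finitary operations on $A$ preserving every relation in $S$. *)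

(* Defs.v *)
From mathcomp Require Import all_boot.
Set Implicit Arguments. Unset Strict Implicit. Unset Printing Implicit Defensive.

(* An n-ary operation on the finite set T (as a finite function, so that
   equality of operations is extensional). *)
Definition op (T : finType) (n : nat) : finType := {ffun {ffun 'I_n -> T} -> T}.

Definition opfam (T : finType) := forall n : nat, {set op T n}.

Definition is_clone (T : finType) (C : opfam T) : Prop :=
  [/\ C 0 = set0,
      (forall n (i : 'I_n), [ffun x : {ffun 'I_n -> T} => x i] \in C n)
    & (forall n m (f : op T n) (g : 'I_n -> op T m),
         0 < m -> f \in C n -> (forall i, g i \in C m) ->
         [ffun x : {ffun 'I_m -> T} => f [ffun i => g i x]] \in C m)].

(* k-edge operation (arity k+1), positions 1..k+1 of the paper are 0..k here. *)
Definition edge_op (T : finType) (k : nat) (t : op T k.+1) : Prop :=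
  forall x y : T,
    [/\ t [ffun j : 'I_k.+1 => if (val j == 0) || (val j == 1) then y else x] = x,
        t [ffun j : 'I_k.+1 => if (val j == 0) || (val j == 2) then y else x] = x
      & forall i : 'I_k.+1, 3 <= val i ->
          t [ffun j : 'I_k.+1 => if j == i then y else x] = x].

Definition has_edge (T : finType) (k : nat) (C : opfam T) : Prop :=
  exists t : op T k.+1, edge_op t /\ t \in C k.+1.

Definition in_Mk (T : finType) (k : nat) (C : opfam T) : Prop :=
  is_clone C /\ has_edge k C.

Definition preserves (T : finType) (n m : nat) (f : op T n)
    (R : {set {ffun 'I_m -> T}}) : bool :=
  [forall r : {ffun 'I_n -> {ffun 'I_m -> T}},
     [forall i, r i \in R] ==> ([ffun j : 'I_m => f [ffun i => r i j]] \in R)].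

Definition Pol (T : finType) (m : nat) (R : {set {ffun 'I_m -> T}}) : opfam T :=
  fun n => [set f : op T n | (0 < n) && preserves f R].

Definition fam_eq (T : finType) (C D : opfam T) : Prop := forall n, C n = D n.

Definition fam_sub (T : finType) (C D : opfam T) : Prop := forall n, C n \subset D n.

Definition fam_ssub (T : finType) (C D : opfam T) : Prop :=
  fam_sub C D /\ ~ fam_sub D C.

(* Main.v *)
(* Following Aichinger, Mayr and McKenzie.  View C n as a subset of T^(T^n), with
   T^n ordered lexicographically, and call (f b, g b) a fork of C at the word b
   if f, g in C n agree on all words before b.  For D inside C with an edge
   operation, equality of the forks at all words and of the projections on fewer
   than k words forces C = D.  The forks at b are also forks at a whenever a is
   obtained from b by deleting letters without losing any first occurrence,
   since merging variables of b turns it into a.  This relation on words is a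
   well-quasi-order by Higman's lemma, so a strictly descending chain, which would
   lose a fork at some word b_i in step i, cannot exist.  For (1), C is the
   intersection of the descending chain of clones Pol(C m); (3) follows from (1),
   as there are only countably many relations. *)
Require Import Defs.
From mathcomp Require Import all_boot.
From Stdlib Require Import ClassicalEpsilon IndefiniteDescription.
Set Implicit Arguments. Unset Strict Implicit. Unset Printing Implicit Defensive.

Lemma nat_argmin (I : Type) (P : I -> Prop) (m : I -> nat) :
  (exists i, P i) -> exists2 i, P i & forall j, P j -> m i <= m j.
Proof.
case=> i; have [n] := ubnP (m i); elim: n i => // n IHn i lt_i Pi.
have [[j Pj lt_j]|min_i] := classic (exists2 j, P j & m j < m i).
  by apply: (IHn j) => //; apply: leq_trans lt_j _.
by exists i => // j Pj; rewrite leqNgt; apply/negP=> lt_j; case: min_i; exists j.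
Qed.

(** * Higman's lemma for words over a finite alphabet *)

Section Higman.

Variable X : finType.
Implicit Types f g : nat -> seq X.

Lemma infinite_pigeonhole (c : nat -> X) :
  exists x, forall N, exists2 n, N <= n & c n = x.
Proof.
apply: NNPP => no_x.
have /fin_all_exists[b hb] x : exists N, forall n, N <= n -> c n <> x.
  apply: NNPP => no_N; case: no_x; exists x => N.
  apply: NNPP => no_n; case: no_N; exists N => n le_n eq_n.
  by case: no_n; exists n.
by apply: (hb (c (\max_x b x)) (\max_x b x)) => //; apply: leq_bigmax.
Qed.

Definition bad f := forall i j, i < j -> ~~ subseq (f i) (f j).

Definition agree_below n f g := forall i, i < n -> f i = g i.

(** Nash-Williams' choice: once the entries before [n] are fixed, the [n]-th is taken as short as
    possible among all bad continuations. *)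
Lemma minimal_bad f : bad f ->
  exists2 g, bad g &
    forall n h, bad h -> agree_below n g h -> size (g n) <= size (h n).
Proof.
move=> bad_f.
pose good_step n (u v : {u | bad u}) :=
  agree_below n (sval u) (sval v) /\
  forall h, bad h -> agree_below n (sval u) h -> size (sval v n) <= size (h n).
have [step stepP] : exists s : nat * {u | bad u} -> {u | bad u},
    forall p, good_step p.1 p.2 (s p).
  apply: (@functional_choice _ _ (fun p v => good_step p.1 p.2 v)).
  case=> n [u bad_u] /=.
  have [|v [bad_v uv] min_v] := @nat_argmin (nat -> seq X)
      (fun v => bad v /\ agree_below n u v) (fun v => size (v n)).
    by exists u; split.
  by exists (exist _ v bad_v); split=> //= h bad_h uh; apply: min_v.
(* [F n] has its final entries below [n], which later steps keep, so the limit [g] is read off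
   diagonally. *)
pose F := fix F n := if n is n'.+1 then step (n', F n') else exist _ f bad_f.
pose g n := sval (F n.+1) n.
have Fg n : agree_below n (sval (F n)) g.
  elim: n => // n IHn i; rewrite ltnS leq_eqVlt => /predU1P[->//|lt_i].
  by rewrite /= -(proj1 (stepP (n, F n))) //= IHn.
exists g => [i j lt_ij|n h bad_h gh].
  have := svalP (F j.+1) _ _ lt_ij.
  by rewrite !Fg // ltnS ltnW.
apply: (proj2 (stepP (n, F n))) => //= i lt_i.
by rewrite Fg // gh.
Qed.

(** In a minimal bad sequence infinitely many entries share a first letter. From the first chosen
    one on, at [n0], keeping only the tails of such entries would give a bad sequence that is
    shorter at [n0]. *)
Lemma higman f : exists i j, i < j /\ subseq (f i) (f j).
Proof.
apply: NNPP => not_good.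
have bad_f : bad f.
  by move=> i j lt_ij; apply/negP => sub; case: not_good; exists i, j.
have [g bad_g min_g] := minimal_bad bad_f.
have gE n : exists p, g n = p.1 :: p.2.
  case E: (g n) => [|x s]; last by exists (x, s).
  by have := bad_g n n.+1 (ltnSn n); rewrite E sub0seq.
have [ht htE] := functional_choice _ gE.
have [x x_inf] := infinite_pigeonhole (fun n => (ht n).1).
have [nx nxP] : exists nx : nat -> nat, forall N, N <= nx N /\ (ht (nx N)).1 = x.
  apply: (@functional_choice _ _ (fun N n => N <= n /\ (ht n).1 = x)) => N.
  by have [n] := x_inf N; exists n.
pose phi := fix phi n := if n is n'.+1 then nx (phi n').+1 else nx 0.
have phi_hd n : (ht (phi n)).1 = x by case: n => [|n]; apply: (nxP _).2.
have phi_lt i j : i < j -> phi i < phi j.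
  elim: j => // j IHj; rewrite ltnS leq_eqVlt => /predU1P[->|/IHj lt_ij].
    exact: (nxP _).1.
  by apply: leq_trans lt_ij _; apply: ltnW; apply: (nxP _).1.
have phi_ge0 n : phi 0 <= phi n by case: n => // n; apply: ltnW; apply: phi_lt.
pose n0 := phi 0.
pose h i := if i < n0 then g i else (ht (phi (i - n0))).2.
have bad_h : bad h.
  move=> i j lt_ij; rewrite /h.
  have [lt_j|le_j] := ltnP j n0; first by rewrite (ltn_trans lt_ij lt_j); apply: bad_g.
  have [lt_i|le_i] := ltnP i n0.
    apply: contra (bad_g i (phi (j - n0)) _) => [sub|].
      by rewrite (htE (phi _)); apply: subseq_trans sub (subseq_cons _ _).
    exact: leq_trans lt_i (phi_ge0 _).
  apply: contra (bad_g (phi (i - n0)) (phi (j - n0)) _) => [sub|].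
    by rewrite !htE !phi_hd /= eqxx.
  by apply: phi_lt; apply: ltn_sub2r => //; apply: leq_ltn_trans lt_ij.
have /(min_g n0 h bad_h) : agree_below n0 g h by move=> i lt_i; rewrite /h lt_i.
by rewrite {1}/h ltnn subnn htE /= ltnn.
Qed.

End Higman.

(** * Forks determine a relation closed under an edge operation *)

Section Forks.

Variables (T I : finType) (k : nat) (t : op T k.+1) (lt : rel I).
Hypotheses (k_gt1 : 1 < k) (t_edge : edge_op t).
Hypotheses (lt_irr : irreflexive lt) (lt_trans : transitive lt).
Hypothesis lt_total : forall i j, i != j -> lt i j || lt j i.

Implicit Types (R S : {set {ffun I -> T}}) (W D : {set I}).

Definition fork R (i : I) (a b : T) := exists f g : {ffun I -> T},
  [/\ f \in R, g \in R, (forall j, lt j i -> f j = g j), f i = a & g i = b].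

Definition pointwise (r : 'I_k.+1 -> {ffun I -> T}) : {ffun I -> T} :=
  [ffun x => t [ffun j => r j x]].

Definition edge_closed R := forall r, (forall j, r j \in R) -> pointwise r \in R.

Lemma edge01 (F : {ffun 'I_k.+1 -> T}) x y :
  (forall j : 'I_k.+1, F j = if (val j == 0) || (val j == 1) then y else x) ->
  t F = x.
Proof.
move=> FE; have [<- _ _] := t_edge x y.
by congr (t _); apply/ffunP=> j; rewrite FE ffunE.
Qed.

Lemma edge02 (F : {ffun 'I_k.+1 -> T}) x y :
  (forall j : 'I_k.+1, F j = if (val j == 0) || (val j == 2) then y else x) ->
  t F = x.
Proof.
move=> FE; have [_ <- _] := t_edge x y.
by congr (t _); apply/ffunP=> j; rewrite FE ffunE.
Qed.

Lemma edge3 (F : {ffun 'I_k.+1 -> T}) x l : 2 < l ->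
  (forall j : 'I_k.+1, val j != l -> F j = x) -> t F = x.
Proof.
(* For [l > k] there is no exceptional position and the tuple is constant. *)
move=> l_gt2 FE; have [l_le|l_gt] := leqP l k; last first.
  apply: (edge01 (y := x)) => j; rewrite if_same FE // neq_ltn.
  by rewrite (leq_ltn_trans (leq_ord j)).
have [_ _ /(_ (Ordinal (l_le : l < k.+1)) l_gt2) <-] :=
  t_edge x (F (Ordinal (l_le : l < k.+1))).
congr (t _); apply/ffunP=> j; rewrite ffunE; case: eqP => [->//|ne_j].
by apply: FE; apply: contra_not_neq ne_j => j_l; apply: val_inj.
Qed.

Section Extend.

Variables (R : {set {ffun I -> T}}) (s r u v : {ffun I -> T}) (i : I).
Hypotheses (R_closed : edge_closed R) (rR : r \in R) (uR : u \in R) (vR : v \in R).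
Hypothesis rs : forall j, lt j i -> r j = s j.
Hypothesis uv : forall j, lt j i -> u j = v j.
Hypotheses (u_i : u i = s i) (v_i : v i = r i).
Hypothesis small : forall W, #|W| < k -> exists2 g, g \in R & {in W, g =1 s}.

(* Induction on #|W|: given solutions g_1, ..., g_(k-1) for W minus one point w_l
   each, change g_1 and r at i to a common value, without disturbing W, to get r0
   and r1; then t(r0, r1, g_1, ..., g_(k-1)) agrees with s on i |: W. *)
Lemma extend_agreement W : {in W, forall j, lt j i} ->
  exists2 g, g \in R & {in i |: W, g =1 s}.
Proof.
have [n] := ubnP #|W|; elim: n W => // n IHn W lt_W W_i.
have [small_W|big_W] := ltnP #|W| k.-1.
  apply: small; rewrite ltn_predRL in small_W; apply: leq_ltn_trans small_W.
  by rewrite cardsU1 -add1n leq_add2r leq_b1.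
have iW : i \notin W by apply/negP => /W_i; rewrite lt_irr.
have /fin_all_exists[g gP] w : exists g, w \in W ->
    [/\ g \in R, g i = s i & {in W, forall j, j != w -> g j = s j}].
  have [wW|] := boolP (w \in W); last by exists r.
  have [||g gR gs] := IHn (W :\ w).
  - by rewrite -ltnS (leq_trans _ lt_W) // (cardsD1 w W) wW.
  - by move=> j; rewrite !inE => /andP[_ /W_i].
  exists g => _; split=> // [|j jW j_w]; first by rewrite gs ?setU11.
  by rewrite gs // !inE j_w jW orbT.
pose w l := nth i (enum W) l.
have size_W l : l < k.-1 -> l < size (enum W).
  by move=> lt_l; rewrite -cardE; apply: leq_trans big_W.
have wW l : l < k.-1 -> w l \in W.
  by move=> lt_l; rewrite -mem_enum mem_nth // size_W.
have k1 : 0 < k.-1 by rewrite ltn_predRL.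
pose tup (x0 x1 : {ffun I -> T}) (j : 'I_k.+1) :=
  match val j with 0 => x0 | 1 => x1 | l.+2 => g (w l) end.
have tup_lt (j : 'I_k.+1) l : val j = l.+2 -> l < k.-1.
  by move=> jl; rewrite ltn_predRL -ltnS -jl /=.
have tupR x0 x1 : x0 \in R -> x1 \in R -> pointwise (tup x0 x1) \in R.
  move=> x0R x1R; apply: R_closed => j; rewrite /tup.
  case jE: (val j) => [|[|l]] //.
  by have [] := gP (w l) (wW _ (tup_lt _ _ jE)).
(* At [j] in [W] only the [g (w l)] with [w l = j] can differ from [s]. For [l = 0] the deviating
   value sits in positions 0 and 2; otherwise it sits in position [l + 2] alone, or nowhere if that
   exceeds [k]. *)
have tup_W (x0 x1 : {ffun I -> T}) : {in W, x0 =1 g (w 0)} -> {in W, x1 =1 s} ->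
    {in W, pointwise (tup x0 x1) =1 s}.
  move=> x0g x1s j jW; rewrite ffunE.
  have gw l : l < k.-1 -> l != index j (enum W) -> g (w l) j = s j.
    move=> lt_l ne_l; have [_ _ ->] := gP _ (wW _ lt_l) => //.
    apply: contraNneq ne_l => ->.
    by rewrite index_uniq ?size_W ?enum_uniq.
  case idx: (index j (enum W)) => [|l0].
    apply: (edge02 (y := g (w 0) j)) => a; rewrite ffunE /tup.
    case aE: (val a) => [|[|[|l]]] //=; rewrite ?x0g ?x1s //.
    by rewrite gw ?(tup_lt a) // idx.
  apply: (@edge3 _ _ l0.+3) => // a; rewrite ffunE /tup.
  case aE: (val a) => [|[|l]] //= ne_l; rewrite ?x0g ?x1s //.
    by rewrite gw // idx.
  by rewrite gw ?(tup_lt a) // idx.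
have [g0R g0i g0s] := gP _ (wW _ k1).
pose r1 := pointwise (tup (g (w 0)) r).
have r1R : r1 \in R by apply: tupR.
have r1s : {in W, r1 =1 s} by apply: tup_W => // j /W_i /rs.
pose r0 := pointwise (fun j => match val j with 0 => u | 1 => v | _ => g (w 0) end).
have r0R : r0 \in R by apply: R_closed => j; case: (val j) => [|[|]].
have r0g : {in W, r0 =1 g (w 0)}.
  move=> j /W_i /uv uvj; rewrite ffunE; apply: (edge01 (y := u j)) => a.
  by rewrite ffunE; case: (val a) => [|[|]].
(* Both values equal t(b, r i, b, ..., b) with b := s i. *)
have r01 : r0 i = r1 i.
  rewrite !ffunE; congr (t _); apply/ffunP => a; rewrite !ffunE /tup.
  case aE: (val a) => [|[|l]]; rewrite ?u_i //.
  by have [_ -> _] := gP _ (wW _ (tup_lt _ _ aE)).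
exists (pointwise (tup r0 r1)); first exact: tupR.
move=> j /setU1P[->|jW]; last exact: tup_W.
rewrite ffunE; apply: (edge01 (y := r0 i)) => a; rewrite ffunE /tup.
case aE: (val a) => [|[|l]] //.
by have [_ -> _] := gP _ (wW _ (tup_lt _ _ aE)).
Qed.

End Extend.

(** Agreement with [s] grows along down-closed sets [D]. If [r] in [R] agrees with [s] below the
    largest [i] in [D], then [s] and [r] form a fork of [S] at [i]; the same fork in [R] serves to
    correct the value at [i]. *)
Lemma fork_lemma R S : R \subset S -> edge_closed R ->
  (forall s W, s \in S -> #|W| < k -> exists2 g, g \in R & {in W, g =1 s}) ->
  (forall i a b, fork S i a b -> fork R i a b) -> S \subset R.
Proof.
move=> sRS R_closed small forkSR; apply/subsetP => s sS.
suff agree_down D : (forall i j, i \in D -> lt j i -> j \in D) ->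
    exists2 r, r \in R & {in D, r =1 s}.
  have [//|r rR rs] := agree_down setT.
  by have -> : s = r by apply/ffunP => j; rewrite rs.
have [n] := ubnP #|D|; elim: n D => // n IHn D lt_D D_down.
have [->|[i0 i0D]] := set_0Vmem D.
  by have [|r rR _] := small s set0 sS; [rewrite cards0 ltnW|exists r => // j; rewrite inE].
(* The number of predecessors is strictly increasing along [lt], so maximizing it gives the largest
   element of [D]. *)
pose below i := #|[set j | lt j i]|.
have [i iD i_max] := arg_maxnP below i0D.
rewrite -/(i \in D) in iD.
have lt_i j : j \in D -> j != i -> lt j i.
  move=> jD /lt_total /orP[//|lt_ij].
  suff: below i < below j by rewrite ltnNge; have /= -> := i_max j jD.
  apply: proper_card; apply/properP; split.
    by apply/subsetP => l; rewrite !inE => /lt_trans; apply.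
  by exists i; rewrite inE ?lt_irr.
have [||r rR rs] := IHn (D :\ i).
- by rewrite -ltnS (leq_trans _ lt_D) // (cardsD1 i D) iD.
- move=> a b; rewrite !inE => /andP[a_i aD] lt_ba; rewrite (D_down a) // andbT.
  apply: contraTneq (lt_i _ aD a_i) => <-; apply/negP => /(lt_trans lt_ba).
  by rewrite lt_irr.
have {}rs j : lt j i -> r j = s j.
  move=> lt_ji; rewrite rs // !inE (D_down i) // andbT.
  by apply: contraTneq lt_ji => ->; rewrite lt_irr.
have /forkSR[u [v [uR vR uv ui vi]]] : fork S i (s i) (r i).
  by exists s, r; split=> // [|j /rs//]; apply: (subsetP sRS).
have [||g gR gs] := extend_agreement R_closed rR uR vR rs uv ui vi _ (W := D :\ i).
- by move=> W; apply: small.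
- by move=> j; rewrite !inE => /andP[j_i jD]; apply: lt_i.
by exists g => // j jD; rewrite gs // setD1K.
Qed.

End Forks.

(** * Embeddings of words and minors of operations *)

Section Words.

Variable T : finType.
Implicit Types (C D : opfam T).

Definition lex n : rel {ffun 'I_n -> T} := fun c b =>
  [exists i : 'I_n, [forall j : 'I_n, (j < i) ==> (c j == b j)]
             && (enum_rank (c i) < enum_rank (b i))].

Lemma lexP n (c b : {ffun 'I_n -> T}) :
  reflect (exists i : 'I_n, (forall j : 'I_n, j < i -> c j = b j)
                            /\ enum_rank (c i) < enum_rank (b i))
          (lex c b).
Proof.
apply: (iffP existsP) => -[i].
  case/andP=> /forallP cb lt_i; exists i; split=> // j lt_j.
  by apply/eqP; apply: (implyP (cb j)).
case=> cb lt_i; exists i; rewrite lt_i andbT.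
by apply/forallP => j; apply/implyP => /cb ->.
Qed.

Lemma lex_irr n : irreflexive (@lex n).
Proof. by move=> b; apply/negbTE/negP => /lexP[i [_]]; rewrite ltnn. Qed.

Lemma lex_trans n : transitive (@lex n).
Proof.
move=> b a c /lexP[i [ab lt_ab]] /lexP[j [bc lt_bc]]; apply/lexP.
case: (ltngtP i j) => [lt_ij|lt_ji|/val_inj ij].
- exists i; split=> [l lt_l|]; last by rewrite -bc.
  by rewrite ab // bc // (ltn_trans lt_l).
- exists j; split=> [l lt_l|]; last by rewrite ab.
  by rewrite ab ?bc // (ltn_trans lt_l).
rewrite -{j}ij in bc lt_bc; exists i; split=> [l lt_l|].
  by rewrite ab ?bc.
exact: ltn_trans lt_bc.
Qed.

Lemma lex_total n (a b : {ffun 'I_n -> T}) : a != b -> lex a b || lex b a.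
Proof.
move=> ne_ab.
have [i0 i0P] : exists i, a i != b i.
  by apply/existsP; apply: contraNT ne_ab; rewrite negb_exists => /forallP ab;
     apply/eqP/ffunP => i; apply/eqP; have := ab i; rewrite negbK.
have [i ne_i min_i] := @arg_minnP _ i0 (fun i => a i != b i) (@nat_of_ord n) i0P.
have ab (j : 'I_n) : j < i -> a j = b j.
  by move=> lt_j; apply/eqP; apply: contraTT lt_j => /min_i; rewrite -leqNgt.
have: val (enum_rank (a i)) != val (enum_rank (b i)).
  by rewrite val_eqE (inj_eq enum_rank_inj).
rewrite neq_ltn => /orP[] lt_i; apply/orP; [left|right]; apply/lexP;
  by exists i; split=> // j /ab.
Qed.

(* The second component marks first occurrences. Together with the third one it
   makes every subword embedding of codes send first occurrences to first
   occurrences and relate words with the same set of letters. *)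
Definition code n (b : {ffun 'I_n -> T}) (u v : T) :
    seq (T * bool * (T * T * {set T})) :=
  [seq (b j, [forall l : 'I_n, (l < j) ==> (b l != b j)],
        (u, v, [set b l | l : 'I_n])) | j <- enum 'I_n].

Lemma subseq_embedding (X : eqType) m n (F : 'I_m -> X) (G : 'I_n -> X) :
  subseq [seq F i | i <- enum 'I_m] [seq G j | j <- enum 'I_n] ->
  exists h : 'I_m -> 'I_n, {homo h : i j / i < j} /\ forall i, F i = G (h i).
Proof.
case/subseqP=> msk _; rewrite -map_mask; set e := mask _ _ => FG.
have size_e : size e == m.
  by have /(congr1 size) := FG; rewrite (size_map F) (size_map G) size_enum_ord => <-.
have e_sorted : sorted ltn [seq val j | j <- e].
  apply: (subseq_sorted ltn_trans (s2 := map val (enum 'I_n))).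
    by rewrite map_subseq ?mask_subseq.
  by rewrite val_enum_ord iota_ltn_sorted.
exists (tnth (Tuple size_e)); split=> [i j lt_ij|i].
  have x0 := tnth (Tuple size_e) i; rewrite !(tnth_nth x0) /=.
  have lt_e (l : 'I_m) : l < size e by rewrite (eqP size_e).
  rewrite -!(nth_map x0 0 val) //.
  by apply: (sorted_ltn_nth ltn_trans) => //; rewrite inE size_map.
have x0 := tnth (Tuple size_e) i; rewrite (tnth_nth x0) /=.
rewrite -(nth_map x0 (F i)) ?(eqP size_e) // -FG (nth_map i) ?size_enum_ord //.
by rewrite nth_ord_enum.
Qed.

(** [h] places [a] inside [b], while [sg] identifies variables so as to turn [b] into [a]. The last
    clause is what makes this identification respect the lexicographic order. *)
Definition word_embed m n (a : {ffun 'I_m -> T}) (b : {ffun 'I_n -> T})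
    (h : 'I_m -> 'I_n) (sg : 'I_n -> 'I_m) :=
  [/\ {homo h : i j / i < j}, cancel h sg, (forall j, a (sg j) = b j)
    & forall j, h (sg j) <= j].

(** [sg] inverts [h] on its image and sends any other position [j] to the first occurrence of [b j]
    in [a]. By the marks, [h] maps that to the first occurrence in [b], which is at most [j]. *)
Lemma code_embed m n (a : {ffun 'I_m -> T}) (b : {ffun 'I_n -> T}) u v u' v' :
  0 < m -> subseq (code a u v) (code b u' v') ->
  [/\ u = u', v = v' & exists h sg, word_embed a b h sg].
Proof.
move=> m_gt0 /subseq_embedding[h [h_lt h_code]].
have [-> -> ab] : [/\ u = u', v = v' & [set a l | l : 'I_m] = [set b l | l : 'I_n]].
  by have [_ _ -> -> ->] := h_code (Ordinal m_gt0).
split=> //; have ah i : a i = b (h i) by have [] := h_code i.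
have h_inj : injective h.
  move=> i j hij; apply: val_inj; case: (ltngtP i j) => // /h_lt.
    by rewrite hij ltnn.
  by rewrite hij ltnn.
have /fin_all_exists[sg sgP] (j : 'I_n) : exists i : 'I_m,
    [/\ a i = b j, h i <= j & forall i0, h i0 = j -> i = i0].
  have [/existsP[i0 /eqP <-]|no_i0] := boolP [exists i0, h i0 == j].
    by exists i0; split=> // i1 /h_inj.
  have [i1 _ i1P] : exists2 i, i \in 'I_m & b j = a i.
    by apply/imsetP; rewrite ab; apply: imset_f.
  have [i /eqP ai min_i] :=
    @arg_minnP _ i1 (fun i => a i == b j) (@nat_of_ord m) (introT eqP (esym i1P)).
  exists i; split=> // [|i0 hi0]; last by case/existsP: no_i0; exists i0; rewrite hi0.
  have [_ mark _ _ _] := h_code i.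
  have: [forall l : 'I_n, (l < h i) ==> (b l != b (h i))].
    rewrite -mark; apply/forallP => l; apply/implyP; rewrite ltnNge.
    by apply: contraNneq => al; apply: min_i; rewrite al ai.
  move/forallP/(_ j); rewrite -ah ai eqxx implybF -leqNgt.
  by [].
exists h, sg; split=> // [i|j|j]; last by case: (sgP j).
  by have [_ _] := sgP (h i); apply.
by case: (sgP j).
Qed.

Definition minor n m (sg : 'I_n -> 'I_m) (f : op T n) : op T m :=
  [ffun x : {ffun 'I_m -> T} => f [ffun j => x (sg j)]].

Lemma clone_arity C n (f : op T n) : is_clone C -> f \in C n -> 0 < n.
Proof. by case=> C0 _ _; case: n f => // f; rewrite C0 inE. Qed.

Lemma clone_minor C n m (sg : 'I_n -> 'I_m) (f : op T n) :
  is_clone C -> 0 < m -> f \in C n -> minor sg f \in C m.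
Proof.
move=> [_ C_proj C_comp] m_gt0 fC.
pose p i : op T m := [ffun x : {ffun 'I_m -> T} => x (sg i)].
have -> : minor sg f = [ffun x => f [ffun i => p i x]].
  apply/ffunP => x; rewrite !ffunE; congr (f _).
  by apply/ffunP => j; rewrite !ffunE.
by apply: C_comp => // i; apply: C_proj.
Qed.

(** The minors along [sg] of a fork at [b] form one at [a]: if [c] first drops below [a] at [i],
    then [c] composed with [sg] first drops below [b] at [h i], because [j < h i] forces
    [sg j < i]. *)
Lemma fork_embed C m n (a : {ffun 'I_m -> T}) (b : {ffun 'I_n -> T}) h sg u v :
  is_clone C -> 0 < m -> word_embed a b h sg ->
  fork (@lex n) (C n) b u v -> fork (@lex m) (C m) a u v.
Proof.
move=> C_clone m_gt0 [h_lt hK asg h_sg] [f [g [fC gC fg fb gb]]].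
have sg_a : [ffun j => a (sg j)] = b by apply/ffunP => j; rewrite ffunE asg.
exists (minor sg f), (minor sg g); split; rewrite ?clone_minor ?ffunE ?sg_a //.
move=> c /lexP[i [ca lt_i]]; rewrite !ffunE; apply: fg; apply/lexP.
exists (h i); split=> [j lt_j|]; rewrite ffunE -asg ?hK //.
apply: ca; rewrite ltnNge; apply: contraL lt_j; rewrite -leqNgt leq_eqVlt.
case/predU1P=> [/val_inj ->|/h_lt lt_h]; first exact: h_sg.
exact: leq_trans (ltnW lt_h) (h_sg j).
Qed.

(* An operation has a minor of arity #|X| from which its values at few words can
   be recovered: identify variables in which all those words agree. *)
Lemma small_projection C D k n (W : {set {ffun 'I_n -> T}}) (s : op T n) :
  is_clone C -> is_clone D ->
  C #|{ffun 'I_k -> T}| = D #|{ffun 'I_k -> T}| ->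
  s \in C n -> #|W| <= k -> exists2 g : op T n, g \in D n & {in W, g =1 s}.
Proof.
move=> C_clone D_clone; move=> CD sC W_small; pose X : finType := {ffun 'I_k -> T}.
have n_gt0 := clone_arity C_clone sC.
pose j0 := Ordinal n_gt0.
have [->|[w0 w0W]] := set_0Vmem W.
  have [_ /(_ n j0) g _] := D_clone.
  by exists [ffun x : {ffun 'I_n -> T} => x j0] => // w; rewrite inE.
(* [e j] is the column of the [j]-th letters of the words in [W]; variables with equal columns get
   identified. *)
pose e (j : 'I_n) : X := [ffun l : 'I_k => nth w0 (enum W) l j].
pose sg1 j := enum_rank (e j).
(* Each column gets a representative variable, with [j0] for columns that do not occur. *)
pose sg2 (c : 'I_#|X|) := odflt j0 [pick j | e j == enum_val c].
have e_sg j : e (sg2 (sg1 j)) = e j.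
  rewrite /sg2 /sg1 enum_rankK; case: pickP => [j' /eqP//|/(_ j)].
  by rewrite eqxx.
have X_gt0 : 0 < #|X| by apply: leq_ltn_trans (ltn_ord (sg1 j0)).
exists (minor sg2 (minor sg1 s)).
  by apply: clone_minor => //; rewrite -CD; apply: clone_minor.
move=> w wW; rewrite !ffunE; congr (s _); apply/ffunP => j; rewrite !ffunE.
have lt_k : index w (enum W) < k.
  by apply: leq_trans W_small; rewrite cardE index_mem mem_enum.
have /ffunP/(_ (Ordinal lt_k)) := e_sg j.
by rewrite !ffunE nth_index ?mem_enum.
Qed.

End Words.

(** * Descending chains of clones with an edge operation *)

Section Chains.

Variables (T : finType) (k : nat).
Hypothesis k_gt1 : 1 < k.
Implicit Types (C D : opfam T).

(** The number of columns over [k.-1] words: by [small_projection], the [N]-ary parts control all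
    projections on fewer than [k] words. *)
Let N := #|{ffun 'I_k.-1 -> T}|.

Lemma clone_sub_of_forks C D n : is_clone C -> in_Mk k D -> fam_sub D C ->
  C N = D N ->
  (forall b u v, fork (@lex T n) (C n) b u v -> fork (@lex T n) (D n) b u v) ->
  C n \subset D n.
Proof.
move=> C_clone [D_clone [t [t_edge tD]]] sDC CD forkCD.
have [->|[s0 s0C]] := set_0Vmem (C n); first exact: sub0set.
have n_gt0 := clone_arity C_clone s0C.
apply: (fork_lemma k_gt1 t_edge (@lex_irr T n) (@lex_trans T n) (@lex_total T n)) => //.
- exact: sDC.
- by case: D_clone => _ _ D_comp r rD; apply: D_comp.
- move=> s W sC W_small; apply: (small_projection C_clone D_clone CD sC).
  by rewrite -ltnS prednK // ltnW.
Qed.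

Lemma no_strict_chain (ch : nat -> opfam T) :
  (forall i, in_Mk k (ch i)) -> ~ (forall i, fam_ssub (ch i.+1) (ch i)).
Proof.
move=> ch_Mk ch_ssub.
have ch_clone i : is_clone (ch i) by case: (ch_Mk i).
have ch_sub i j : i <= j -> fam_sub (ch j) (ch i).
  elim: j => [|j IHj]; first by rewrite leqn0 => /eqP ->.
  rewrite leq_eqVlt => /predU1P[->//|/IHj sub n].
  exact: subset_trans ((ch_ssub j).1 n) (sub n).
(* The [N]-ary parts descend, so they are constant from an index of least cardinality on. *)
have [|i0 _ min_i0] := @nat_argmin nat xpredT (fun i => #|ch i N|).
  by exists 0.
have stable i : ch (i0 + i) N = ch i0 N.
  by apply/eqP; rewrite eqEcard min_i0 // ch_sub ?leq_addr.
have [F FP] : exists F : nat -> {n : nat & ({ffun 'I_n -> T} * T * T)%type},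
    forall i, let: existT n (b, u, v) := F i in
    fork (@lex T n) (ch (i0 + i) n) b u v /\
    ~ fork (@lex T n) (ch (i0 + i).+1 n) b u v.
  apply: (@functional_choice _ _ (fun i Fi => let: existT n (b, u, v) := Fi in
    fork (@lex T n) (ch (i0 + i) n) b u v /\
    ~ fork (@lex T n) (ch (i0 + i).+1 n) b u v)) => i.
  apply: NNPP => no_fork; have [sub] := ch_ssub (i0 + i); apply => n.
  apply: clone_sub_of_forks => //; first by rewrite -addnS !stable.
  move=> b u v fork_b; apply: NNPP => not_fork.
  by apply: no_fork; exists (existT _ n (b, u, v)).
(* The word of step [i] embeds in that of a later step [j], with the same fork values. The fork of
   step [j] lies in [ch (i0 + i).+1], so it transfers back to the word where it was lost. *)
have [i [j [lt_ij]]] := higman (fun i => let: existT n (b, u, v) := F i in code b u v).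
have := FP i; have := FP j.
case: (F i) => m [[a u] v]; case: (F j) => n [[b u'] v'].
case=> fork_b _ [fork_a not_fork_a] sub.
have [f [_ [fC _ _ _ _]]] := fork_a.
have m_gt0 := clone_arity (ch_clone _) fC.
have [eq_u eq_v [h [sg emb]]] := code_embed m_gt0 sub.
apply: not_fork_a; rewrite eq_u eq_v; apply: (fork_embed _ m_gt0 emb) => //.
have sub_ij : fam_sub (ch (i0 + j)) (ch (i0 + i).+1).
  by apply: ch_sub; rewrite -addnS leq_add2l.
have [f' [g' [f'C g'C ? ? ?]]] := fork_b.
by exists f', g'; split=> //; apply: (subsetP (sub_ij n)).
Qed.

Lemma chain_stabilizes (ch : nat -> opfam T) :
  (forall i, in_Mk k (ch i)) -> (forall i j, i <= j -> fam_sub (ch j) (ch i)) ->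
  exists i, forall j, i <= j -> fam_sub (ch i) (ch j).
Proof.
move=> ch_Mk ch_sub; apply: NNPP => unstable.
have [next nextP] : exists next : nat -> nat,
    forall i, i <= next i /\ ~ fam_sub (ch i) (ch (next i)).
  apply: (@functional_choice _ _
    (fun i j => i <= j /\ ~ fam_sub (ch i) (ch j))) => i.
  apply: NNPP => no_j; apply: unstable; exists i => j le_ij.
  by apply: NNPP => not_sub; apply: no_j; exists j.
apply: (@no_strict_chain (fun i => ch (iter i next 0))) => // i.
by have [le_next not_sub] := nextP (iter i next 0); split=> //; apply: ch_sub.
Qed.

(** * Relations that encode the parts of a clone *)

Lemma preservesP n m (f : op T n) (R : {set {ffun 'I_m -> T}}) :
  reflect (forall r : 'I_n -> {ffun 'I_m -> T}, (forall i, r i \in R) ->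
             [ffun j => f [ffun i => r i j]] \in R)
          (preserves f R).
Proof.
apply: (iffP forallP) => [fR r rR|fR r].
  have /implyP := fR [ffun i => r i].
  have -> : [ffun j => f [ffun i => [ffun i0 => r i0] i j]] =
            [ffun j => f [ffun i => r i j]] :> {ffun 'I_m -> T}.
    apply/ffunP => j; rewrite !ffunE; congr (f _).
    by apply/ffunP => i; rewrite !ffunE.
  by apply; apply/forallP => i; rewrite ffunE.
by apply/implyP => /forallP rR; apply: fR.
Qed.

Lemma Pol_clone m (R : {set {ffun 'I_m -> T}}) : is_clone (Pol R).
Proof.
split=> [|n i|n l f g l_gt0].
- by apply/setP => f; rewrite !inE.
- rewrite inE (leq_ltn_trans _ (ltn_ord i)) //=; apply/preservesP => r rR.
  suff -> : [ffun j => [ffun x : {ffun 'I_n -> T} => x i] [ffun i => r i j]] = r i by [].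
  by apply/ffunP => j; rewrite !ffunE.
rewrite !inE l_gt0 => /andP[_ /preservesP fR] gR; apply/preservesP => r rR.
pose r' i := [ffun j => g i [ffun l => r l j]] : {ffun 'I_m -> T}.
suff -> : [ffun j => [ffun x : {ffun 'I_l -> T} => f [ffun i => g i x]]
                       [ffun i => r i j]] = [ffun j => f [ffun i => r' i j]].
  apply: fR => i; have := gR i; rewrite inE l_gt0 => /preservesP; exact.
apply/ffunP => j; rewrite !ffunE; congr (f _).
by apply/ffunP => i; rewrite !ffunE.
Qed.

(** The value tables of the [m]-ary members, with argument tuples numbered by [enum_val]. Preserving
    it means composing members of [C m] into [C m]. *)
Definition graph_rel C m : {set {ffun 'I_#|{ffun 'I_m -> T}| -> T}} :=
  [set [ffun j => f (enum_val j)] | f : op T m in C m].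

Lemma preserves_graph_rel C n m (f : op T n) :
  reflect (forall g : 'I_n -> op T m, (forall i, g i \in C m) ->
             [ffun x : {ffun 'I_m -> T} => f [ffun i => g i x]] \in C m)
          (preserves f (graph_rel C m)).
Proof.
pose tab (g : op T m) : {ffun 'I_#|{ffun 'I_m -> T}| -> T} :=
  [ffun j => g (enum_val j)].
have tab_inj : injective tab.
  move=> g g' /ffunP eq_tab; apply/ffunP => x.
  by have := eq_tab (enum_rank x); rewrite !ffunE enum_rankK.
have tabE g : (tab g \in graph_rel C m) = (g \in C m) by apply: mem_imset.
have tab_comp (g : 'I_n -> op T m) : [ffun j => f [ffun i => tab (g i) j]] =
    tab [ffun x : {ffun 'I_m -> T} => f [ffun i => g i x]].
  apply/ffunP => j; rewrite !ffunE; congr (f _).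
  by apply/ffunP => i; rewrite !ffunE.
apply: (iffP (preservesP _ _)) => fC.
  by move=> g gC; rewrite -tabE -tab_comp; apply: fC => i; rewrite tabE.
move=> r rC.
have /fin_all_exists[g gP] i : exists g, g \in C m /\ r i = tab g.
  by have /imsetP[g gC ->] := rC i; exists g.
have -> : [ffun j => f [ffun i => r i j]] = [ffun j => f [ffun i => tab (g i) j]].
  apply/ffunP => j; rewrite !ffunE; congr (f _).
  by apply/ffunP => i; rewrite !ffunE (gP i).2 ffunE.
by rewrite tab_comp tabE; apply: fC => i; case: (gP i).
Qed.

Lemma Pol_graph_rel_sup C m : is_clone C -> 0 < m ->
  fam_sub C (Pol (graph_rel C m)).
Proof.
move=> C_clone m_gt0 n; apply/subsetP => f fC.
rewrite inE (clone_arity C_clone fC); apply/preserves_graph_rel => g gC.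
by case: C_clone => _ _; apply.
Qed.

(** Operations of arity [m] are padded with dummy variables along [up], composed in arity [m'], and
    brought back along [down], which sends the extra variables to [m0]. *)
Lemma Pol_graph_rel_le C m m' : is_clone C -> 0 < m -> m <= m' ->
  fam_sub (Pol (graph_rel C m')) (Pol (graph_rel C m)).
Proof.
move=> C_clone m_gt0 le_m n; apply/subsetP => f; rewrite !inE.
case/andP=> -> /preserves_graph_rel fC; apply/preserves_graph_rel => g gC.
pose up := widen_ord le_m; pose m0 := Ordinal m_gt0.
pose down (j : 'I_m') : 'I_m := insubd m0 (val j).
have downK : cancel up down by move=> i; rewrite /down /up /= valKd.
have upC i : minor up (g i) \in C m'.
  by apply: clone_minor (gC i) => //; exact: leq_trans m_gt0 le_m.
suff -> : [ffun x : {ffun 'I_m -> T} => f [ffun i => g i x]] =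
    minor down [ffun x => f [ffun i => minor up (g i) x]].
  by apply: clone_minor (fC _ upC).
apply/ffunP => x; rewrite !ffunE; congr (f _).
apply/ffunP => i; rewrite !ffunE; congr (g i _).
by apply/ffunP => j; rewrite !ffunE downK.
Qed.

Lemma Pol_graph_rel_arity C n : is_clone C -> 0 < n ->
  Pol (graph_rel C n) n \subset C n.
Proof.
move=> [_ C_proj _] n_gt0; apply/subsetP => f; rewrite inE n_gt0 => /preserves_graph_rel fC.
pose p i : op T n := [ffun x : {ffun 'I_n -> T} => x i].
suff -> : f = [ffun x => f [ffun i => p i x]] by apply: fC => i; apply: C_proj.
apply/ffunP => x; rewrite ffunE; congr (f _).
by apply/ffunP => j; rewrite !ffunE.
Qed.

Lemma finitely_related C : in_Mk k C ->
  exists (m : nat) (R : {set {ffun 'I_m -> T}}), fam_eq C (Pol R).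
Proof.
move=> [C_clone [t [t_edge tC]]].
have sup m : fam_sub C (Pol (graph_rel C m.+1)) by apply: Pol_graph_rel_sup.
(* The shift to [m.+1] keeps the arities positive. An operation of arity [n.+1] in the stable clone
   also lies in the one with index [maxn m n], hence preserves the table of [C n.+1]; applied to
   projections, it lands in [C]. *)
have [m|i j le_ij|m stable] :=
  @chain_stabilizes (fun m => Pol (graph_rel C m.+1)).
- by split; [apply: Pol_clone|exists t; split=> //; apply: (subsetP (sup m _))].
- exact: Pol_graph_rel_le.
exists _, (graph_rel C m.+1) => n; apply/eqP; rewrite eqEsubset sup /=.
case: n => [|n]; first by case: (Pol_clone (graph_rel C m.+1)) => ->; rewrite sub0set.
apply: subset_trans (stable (maxn m n) (leq_maxl _ _) n.+1) _.
apply: subset_trans (Pol_graph_rel_arity C_clone (ltn0Sn n)).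
by apply: Pol_graph_rel_le; rewrite // ltnS leq_maxr.
Qed.

End Chains.

Theorem theorem6p2 (T : finType) (k : nat) (hk : 1 < k) :
  [/\ (forall C : opfam T, in_Mk k C ->
         exists (m : nat) (R : {set {ffun 'I_m -> T}}), fam_eq C (Pol R)),
      ~ (exists ch : nat -> opfam T,
           (forall i, in_Mk k (ch i)) /\ (forall i, fam_ssub (ch i.+1) (ch i)))
    & exists enc : opfam T -> nat,
        forall C D : opfam T, in_Mk k C -> in_Mk k D ->
          enc C = enc D -> fam_eq C D].
Proof.
split=> [C|[ch [ch_Mk ch_ssub]]|]; first exact: finitely_related.
  exact: (no_strict_chain hk ch_Mk).
pose codes C c := exists2 R : {m : nat & {set {ffun 'I_m -> T}}},
  fam_eq C (Pol (tagged R)) & c = pickle R.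
(* [epsilon] chooses one code per family, with [0] witnessing that [nat] is inhabited. On [in_Mk] a
   code exists, and unpickling recovers a relation that determines the clone. *)
pose enc C := epsilon (inhabits 0) (codes C).
have encP C : in_Mk k C -> codes C (enc C).
  move=> /(finitely_related hk)[m [R CR]]; apply: epsilon_spec.
  by exists (pickle (existT (fun m => {set {ffun 'I_m -> T}}) m R)), (existT _ m R).
exists enc => C D /encP[R CR ->] /encP[R' DR' ->] /(pcan_inj pickleK) RR' n.
by rewrite CR DR' RR'.
Qed.
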